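(* Let $(X,G)$ be a dynamical system with a transitive point $p\in X$. Then the following assertions are equivalent: (i) $(X,G)$ is a weakly almost periodic dynamical system. (ii) Every $x\in X$ is weakly almost periodic. (iii) The point $p\in X$ is weakly almost periodic.
   Context: $G$ is a locally compact, $\sigma$-compact abelian group, written additively. A dynamical system $(X,G)$ is a compact metrizable space $X$ with a continuous action $G\times X\to X$, $(t,x)\mapsto tx$. A point is transitive if its orbit is dense in $X$. $C(X)$ is the Banach space of continuous complex-valued functions on $X$ with the supremum norm, and $C_u(G)$ is the Banach space of uniformly continuous bounded complex-valued functions on $G$ with the supremum norm. A function $g\in C_u(G)$ is weakly almost periodic if $\{g(\cdot-t):t\in G\}$ is relatively compact in the weak topology of the Banach space $C_u(G)$. For $f\in C(X)$ and $x\in X$ put $f_x(t)=f(tx)$, $t\in G$ (then $f_x\in C_u(G)$). A point $x\in X$ is weakly almost periodic if $f_x$ is weakly almost periodic for every $f\in C(X)$. The dynamical system $(X,G)$ is weakly almost periodic if for every $f\in C(X)$ the family $\{f_t:t\in G\}$, where $f_t(x)=f(tx)$ for $x\in X$, has compact closure in the weak topology of the Banach space $C(X)$. *)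

(* Defs.v *)
From HB Require Import structures.
From mathcomp Require Import all_boot all_order all_algebra complex.
From mathcomp Require Import boolp classical_sets functions reals topology.
From mathcomp Require Import normedtype tvs.

Set Implicit Arguments.
Unset Strict Implicit.
Unset Printing Implicit Defensive.

Import Order.TTheory GRing.Theory Num.Theory.
Import numFieldNormedType.Exports.

Local Open Scope classical_set_scope.
Local Open Scope ring_scope.
Local Open Scope complex_scope.

(* [R[i]] carries no topology; the alias [R[i]^o] has the one induced by the
   modulus, as for every numFieldType. *)
Notation Cplx R := (R[i]^o).

(* The norm of a complex number is an element of [R[i]] with zero imaginary
   part. *)
Definition modulus (R : realType) (z : Cplx R) : R := complex.Re `|z|.

Record funSpace (R : realType) (T : Type) := FunSpace {
  fun_mem : set (T -> Cplx R);
  fun_mem0 : fun_mem 0;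
  fun_memP : forall (a : R[i]) f g, fun_mem f -> fun_mem g ->
    fun_mem (a *: f + g);
  fun_mem_bounded : fun_mem `<=` bounded_fun }.

Definition fun_pred (R : realType) (T : Type) (F : funSpace R T) :
  {pred T -> Cplx R} := mem (fun_mem F).

Record funType (R : realType) (T : Type) (F : funSpace R T) := FunType {
  fun_val :> T -> Cplx R;
  fun_valP : fun_val \in fun_pred F }.

Definition mkfun (R : realType) (T : Type) (F : funSpace R T)
  (f : T -> Cplx R) (Ff : fun_mem F f) : funType F := FunType (mem_set Ff).

Lemma modulusE (R : realType) (z : Cplx R) : `|z| = (modulus z)%:C.
Proof. by rewrite /modulus RRe_real// normr_real. Qed.

Lemma modulus_ge0 (R : realType) (z : Cplx R) : 0 <= modulus z.
Proof. by rewrite -lecR -modulusE normr_ge0. Qed.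

Section SupNorm.
Context (R : realType) (T : Type) (F : funSpace R T).

Let fun_submod : submod_closed (fun_pred F).
Proof.
split=> [|a f g]; first by apply/mem_set; exact: fun_mem0.
move=> /set_mem Ff /set_mem Fg; apply/mem_set.
exact: fun_memP.
Qed.
HB.instance Definition _ :=
  GRing.isSubmodClosed.Build _ _ (fun_pred F) fun_submod.

HB.instance Definition _ := [isSub for @fun_val R T F].
HB.instance Definition _ := [Choice of funType F by <:].
HB.instance Definition _ := [SubChoice_isSubLmodule of funType F by <:].

(* [sup set0 = 0], so the formula is also right when [T] is empty. *)
Definition sup_norm (f : funType F) : R[i] :=
  (sup [set modulus (f t) | t in [set: T]])%:C.

Let ubound_modulus (f : funType F) :
  has_ubound [set modulus (f t) | t in [set: T]].
Proof.
have [M [/complex_realP[m ->] Mf]] := fun_mem_bounded (set_mem (fun_valP f)).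
exists (m + 1) => _ [t _ <-]; rewrite -lecR -modulusE.
by apply: Mf => //; rewrite ltcR ltrDl.
Qed.

Let le_sup_norm (f : funType F) t : `|f t| <= sup_norm f.
Proof.
by rewrite modulusE lecR; apply: ub_le_sup; [exact: ubound_modulus|exists t].
Qed.

Let sup_norm_le (f : funType F) (M : R) : 0 <= M ->
  (forall t, `|f t| <= M%:C) -> sup_norm f <= M%:C.
Proof.
move=> M0 fM; rewrite lecR; have [->|/set0P ne] :=
  eqVneq [set modulus (f t) | t in [set: T]] set0; first by rewrite sup0.
by apply: ge_sup => // _ [t _ <-]; rewrite -lecR -modulusE.
Qed.

Let sup_norm_real (f : funType F) : exists2 M : R, 0 <= M & sup_norm f = M%:C.
Proof.
exists (sup [set modulus (f t) | t in [set: T]]); last by [].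
have [->|/set0P[_ [t _ _]]] :=
  eqVneq [set modulus (f t) | t in [set: T]] set0; first by rewrite sup0.
by rewrite -lecR; apply: le_trans (normr_ge0 _) (le_sup_norm f t).
Qed.

Let sup_normD (f g : funType F) : sup_norm (f + g) <= sup_norm f + sup_norm g.
Proof.
have [M M0 fM] := sup_norm_real f; have [N N0 gN] := sup_norm_real g.
rewrite fM gN -rmorphD; apply: sup_norm_le => [|t]; first exact: addr_ge0.
by rewrite rmorphD/= -fM -gN (le_trans (ler_normD _ _))// lerD.
Qed.

Let sup_normZ_le (a : R[i]) (f : funType F) :
  sup_norm (a *: f) <= `|a| * sup_norm f.
Proof.
have [M M0 fM] := sup_norm_real f.
rewrite fM (modulusE a) -rmorphM; apply: sup_norm_le => [|t].
  by rewrite mulr_ge0// modulus_ge0.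
by rewrite rmorphM/= -modulusE -fM [leLHS]normrM ler_wpM2l.
Qed.

Let sup_normZ (a : R[i]) (f : funType F) :
  sup_norm (a *: f) = `|a| * sup_norm f.
Proof.
apply/eqP; rewrite eq_le sup_normZ_le/=.
have [->|a0] := eqVneq a 0.
  by rewrite normr0 mul0r; have [M M0 ->] := sup_norm_real (0 *: f); rewrite lecR.
rewrite -ler_pdivlMl ?normr_gt0// -normfV.
by rewrite -[in leLHS](scalerK a0 f) sup_normZ_le.
Qed.

Let sup_norm_eq0 (f : funType F) : sup_norm f = 0 -> f = 0.
Proof.
move=> f0; apply/val_inj/funext => t /=.
by apply/eqP; rewrite -normr_le0 -f0.
Qed.

HB.instance Definition _ := @Lmodule_isNormed.Build R[i] (funType F)
  sup_norm sup_normD sup_normZ sup_norm_eq0.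

End SupNorm.

(* Only continuous functionals that are linear over the whole scalar field of the
   space belong to the dual: complex-linear ones for a complex space. *)
Definition dual_space (K : numFieldType) (V : normedModType K) : Type :=
  {l : {linear V -> K^o} | continuous l}.

Definition weak_topology (K : numFieldType) (V : normedModType K) : Type :=
  sup_topology (fun l : dual_space V =>
    Topological.class (initial_topology (sval l : V -> K^o))).

HB.instance Definition _ (K : numFieldType) (V : normedModType K) :=
  Topological.on (weak_topology V).

Section ContinuousFunctions.
Context (R : realType) (X : topologicalType) (cX : compact [set: X]).

Let cts_mem : set (X -> Cplx R) := [set f | continuous f].

Let cts_mem0 : cts_mem 0.
Proof. by move=> x; exact: cvg_cst. Qed.

Let cts_memP (a : R[i]) f g : cts_mem f -> cts_mem g -> cts_mem (a *: f + g).
Proof.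
move=> cf cg x; apply: (@cvgD _ (Cplx R)); last exact: cg.
by apply: cvgZl_tmp; exact: cf.
Qed.

Let cts_mem_bounded : cts_mem `<=` bounded_fun.
Proof.
move=> f cf.
have near_cov := (compact_near_coveringP _).1 cX.
have /near_cov : forall x, [set: X] x ->
    \forall x' \near x & M \near (+oo : set_system R[i]), `|f x'| <= M.
  move=> x _; near=> x' M => /=.
  have -> : f x' = f x - (f x - f x') by rewrite subKr.
  rewrite (le_trans (ler_normB _ _))// (@le_trans _ _ (`|f x| + 1))//.
    rewrite lerD2l ltW//; near: x'.
    by have /cvgrPdist_lt := cf x; apply.
  by near: M; apply: nbhs_pinfty_ge; rewrite realD.
by apply: filterS => M fM x _; exact: fM.
Unshelve. all: by end_near. Qed.

Definition continuous_funSpace : funSpace R X :=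
  FunSpace cts_mem0 cts_memP cts_mem_bounded.

End ContinuousFunctions.

(* Uniform continuity for the group uniformity, whose entourages are generated
   by the sets of pairs (s, t) with s - t in a given neighborhood of 0; this
   uniformity is not an instance on topologicalZmodType. *)
Definition unif_continuous_group (R : realType) (G : topologicalZmodType)
    (g : G -> Cplx R) : Prop :=
  forall e : R, 0 < e ->
    \forall u \near (0 : G), forall t, `|g (t + u) - g t| < e%:C.

Section UniformlyContinuousFunctions.
Context (R : realType) (G : topologicalZmodType).

Let cu_mem : set (G -> Cplx R) :=
  [set g | unif_continuous_group g /\ bounded_fun g].

Let cu_mem0 : cu_mem 0.
Proof.
split; last exact: bounded_cst.
by move=> e e0; apply: nearW => u t; rewrite subrr normr0 ltcR.
Qed.

Let cu_memP (a : R[i]) f g : cu_mem f -> cu_mem g -> cu_mem (a *: f + g).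
Proof.
move=> [uf bf] [ug bg]; split.
  move=> e e0; pose d := e / 2 / (modulus a + 1).
  have a0 : 0 < modulus a + 1 by rewrite ltr_wpDl ?modulus_ge0.
  have d0 : 0 < d by rewrite !divr_gt0.
  have e20 : 0 < e / 2 by rewrite divr_gt0.
  near=> u => t.
  have -> : (a *: f + g) (t + u) - (a *: f + g) t =
      a *: (f (t + u) - f t) + (g (t + u) - g t).
    by rewrite scalerBr addrACA -opprD.
  rewrite (le_lt_trans (ler_normD _ _))// normrZ (splitr e) rmorphD/= ltrD//.
    rewrite (@le_lt_trans _ _ (`|a| * d%:C))//.
      by rewrite ler_wpM2l// ltW//; move: t; near: u; exact: uf.
    rewrite modulusE -rmorphM/= ltcR /d mulrCA gtr_pMr//.
    by rewrite ltr_pdivrMr// mul1r ltrDl.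
  by move: t; near: u; exact: ug.
have [M [Mr fM]] := bf; have [N [Nr gN]] := bg.
exists (`|a| * (M + 1) + (N + 1)); split=> [|K /ltW K_ge t _ /=].
  by rewrite !(realD, realM) ?normr_real ?real1.
apply: le_trans K_ge.
rewrite (le_trans (ler_normD _ _))// lerD//; last by rewrite gN// ltrDl.
by rewrite [leLHS]normrM ler_wpM2l// fM// ltrDl.
Unshelve. all: by end_near. Qed.

Let cu_mem_bounded : cu_mem `<=` bounded_fun.
Proof. by move=> g []. Qed.

Definition unif_continuous_funSpace : funSpace R G :=
  FunSpace cu_mem0 cu_memP cu_mem_bounded.

End UniformlyContinuousFunctions.

Definition sigma_compact (T : topologicalType) : Prop :=
  exists K : nat -> set T, (forall n, compact (K n)) /\ \bigcup_n K n = [set: T].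

Definition metrizable (R : realType) (T : topologicalType) : Prop :=
  exists (M : metricType R) (f : T -> M) (g : M -> T),
    [/\ continuous f, continuous g, cancel f g & cancel g f].

Record dynamicalSystem (R : realType) (G : topologicalZmodType) :=
  DynamicalSystem {
    phase :> topologicalType;
    phase_compact : compact [set: phase];
    phase_metrizable : metrizable R phase;
    act : G -> phase -> phase;
    act0 : forall x, act 0 x = x;
    actD : forall s t x, act (s + t) x = act s (act t x);
    act_continuous : continuous (fun z : G * phase => act z.1 z.2) }.

Section WeakAlmostPeriodicity.
Context (R : realType) (G : topologicalZmodType).

Definition Cu : normedModType R[i] := funType (unif_continuous_funSpace R G).

Lemma translate_Cu (g : Cu) (t : G) :
  fun_mem (unif_continuous_funSpace R G) (fun s => g (s - t)).
Proof.
have [ug [M [Mr gM]]] := set_mem (fun_valP g); split=> [e e0|].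
  apply: filterS (ug e e0) => u gu s.
  by rewrite addrAC gu.
by exists M; split=> // N MN s _; exact: gM.
Qed.

Definition translate (g : Cu) (t : G) : Cu := mkfun (translate_Cu g t).

Definition wap_fun (g : Cu) : Prop :=
  @precompact (weak_topology Cu) (range (translate g)).

Context (X : dynamicalSystem R G).

Definition CX : normedModType R[i] :=
  funType (continuous_funSpace R (@phase_compact R G X)).

Lemma orbit_fun_Cu (f : CX) (x : X) :
  fun_mem (unif_continuous_funSpace R G) (fun t => f (act t x)).
Proof.
have cf : continuous f := set_mem (fun_valP f).
split=> [e e0|]; last first.
  have [M [Mr fM]] := fun_mem_bounded (set_mem (fun_valP f)).
  by exists M; split=> // N MN t _; exact: fM.
have e20 : 0 < (e / 2)%:C :> R[i] by rewrite ltcR divr_gt0.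
have near_cov := (compact_near_coveringP _).1 (@phase_compact R G X).
pose P (u : G) (y : X) := `|f (act u y) - f y| < e%:C.
have /near_cov : forall y, [set: X] y ->
    \forall y' \near y & u \near nbhs (0 : G), P u y'.
  rewrite /P => y _.
  have cfy : f y' @[y' --> y] --> f y by exact: cf.
  have cfa : f (act z.1 z.2) @[z --> ((0 : G), y)] --> f y.
    rewrite -[in X in _ --> X](act0 y).
    apply: (@continuous_comp _ _ _ (fun z : G * X => act z.1 z.2) f (0, y)).
      exact: act_continuous.
    exact: cf.
  move/cvgrPdist_lt : cfy => /(_ _ e20) fy.
  move/cvgrPdist_lt : cfa => /(_ _ e20)[[U V] /= [U0 Vy] UVf].
  near=> y' u => /=.
  rewrite [e]splitr rmorphD/= -(subrKA (f y)) (le_lt_trans (ler_normD _ _))//.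
  rewrite ltrD//; last by near: y'.
  rewrite distrC; apply: (UVf (u, y')); split => /=; last by near: y'.
  by near: u.
apply: filterS => u fu t; rewrite (addrC t) actD.
exact: (fu _ I).
Unshelve. all: by end_near. Qed.

Definition orbit_fun (f : CX) (x : X) : Cu := mkfun (orbit_fun_Cu f x).

Definition wap_point (x : X) : Prop := forall f : CX, wap_fun (orbit_fun f x).

Lemma shift_CX (f : CX) (t : G) :
  fun_mem (continuous_funSpace R (@phase_compact R G X)) (fun x => f (act t x)).
Proof.
have cf : continuous f := set_mem (fun_valP f).
move=> x; apply: (@continuous_comp _ _ _ (act t) f); last exact: cf.
apply: (@continuous_comp _ _ _ (fun y : X => (t, y))
  (fun z : G * X => act z.1 z.2)); last exact: act_continuous.
by apply: cvg_pair => /=; [exact: cvg_cst|exact: cvg_id].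
Qed.

Definition shift_fun (f : CX) (t : G) : CX := mkfun (@shift_CX f t).

Definition wap_system : Prop := forall f : CX,
  @compact (weak_topology CX) (@closure (weak_topology CX) (range (shift_fun f))).

Definition transitive_point (p : X) : Prop :=
  dense (range (fun t : G => act t p)).

End WeakAlmostPeriodicity.

Arguments wap_system {R G} X.
Arguments wap_point {R G X} x.
Arguments transitive_point {R G X} p.

(* Main.v *)
From HB Require Import structures.
Require Import Defs.
From mathcomp Require Import all_boot all_order all_algebra complex.
From mathcomp Require Import boolp classical_sets functions reals topology.
From mathcomp Require Import normedtype tvs.
From mathcomp Require Import ring lra.

(* (i) => (ii): for every x, the map f |-> f_x from C(X) to C_u(G) is linear and
   contractive, hence weakly continuous, and it sends the orbit of f onto the set
   of translates of f_x.

   (iii) => (i): as the orbit of p is dense, f |-> f_p is an isometry. By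
   Hahn-Banach every functional on C(X) factors through it, so that the weak
   topology of C(X) is induced by that of C_u(G), and its range is weakly closed
   because it is norm closed; hence preimages of weakly compact sets are weakly
   compact. That the range is norm closed needs no completeness of C(X): extend
   each evaluation at x in X to a contractive functional E_x on C_u(G); if g is a
   norm limit of functions f_p, then the corresponding f converge uniformly to
   x |-> E_x g. *)

Set Implicit Arguments.
Unset Strict Implicit.
Unset Printing Implicit Defensive.

Import Order.TTheory GRing.Theory Num.Theory.
Import numFieldNormedType.Exports.

Local Open Scope classical_set_scope.
Local Open Scope ring_scope.
Local Open Scope complex_scope.

(** * The Hahn-Banach theorem *)

(* A partially defined linear map is represented by its graph; functionality
   follows from domination by a subadditive function. *)
Definition linear_graph (K : pzRingType) (U V : lmodType K) (A : set (U * V)) :=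
  A (0, 0) /\
  forall (a : K) u v r s, A (u, r) -> A (v, s) -> A (a *: u + v, a *: r + s).

Section RealHahnBanach.
Context (R : realType) (V : lmodType R) (q : V -> R).
Hypothesis qD : forall u v, q (u + v) <= q u + q v.
Hypothesis qZ : forall (a : R) v, 0 < a -> q (a *: v) = a * q v.

Let dominated (A : set (V * R^o)) := forall v r, A (v, r) -> r <= q v.

Let q0 : q 0 = 0.
Proof.
(* Homogeneity with scalar 2 gives [q 0 = 2 * q 0]. *)
have := qZ 0 (ltr0Sn R 1); rewrite scaler0 => q00.
lra.
Qed.

(** The difference of two values at [v] is a value at 0, hence at most [q 0 = 0]; exchange the
    two. *)
Let graph_functional (A : set (V * R^o)) v r s :
  linear_graph A -> dominated A -> A (v, r) -> A (v, s) -> r = s.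
Proof.
move=> [A0 AP] Aq; suff le r' s' : A (v, r') -> A (v, s') -> s' <= r'.
  by move=> Ar As; apply/eqP; rewrite eq_le !le.
move=> Ar As; have /Aq : A (0, - r' + s').
  by have := AP (-1) _ _ _ _ Ar As; rewrite !scaleN1r addNr.
by rewrite q0; lra.
Qed.

(** The value [c] at [v] must lie above all [r - q (u - v)] and below all [q (u + v) - r], for
    [(u, r)] in [A]. Subadditivity puts every lower bound below every upper one, so the supremum of
    the former serves. *)
Let graph_step (A : set (V * R^o)) v : linear_graph A -> dominated A ->
  exists c : R, let B :=
      [set (u.1 + a *: v, u.2 + a * c : R^o) | u in A & a in [set: R]] in
    linear_graph B /\ dominated B.
Proof.
move=> [A0 AP] Aq.
pose S := [set u.2 - q (u.1 - v) | u in A].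
have S0 : S !=set0 by exists (0 - q (0 - v)); exists (0, 0).
have Sub u : A u -> ubound S (q (u.1 + v) - u.2).
  case: u => u r Au _ [[w s] Aw <-] /=.
  have /Aq : A (u + w, r + s).
    by have := AP 1 _ _ _ _ Au Aw; rewrite !scale1r.
  have := qD (w - v) (u + v).
  by rewrite addrACA [- v + v]addNr addr0 [w + u]addrC; lra.
pose c := sup S.
have cge u : A u -> u.2 - q (u.1 - v) <= c.
  move=> Au; apply: ub_le_sup; last by exists u.
  by exists (q (0 + v) - 0); exact: (Sub (0, 0)).
have cle u : A u -> c <= q (u.1 + v) - u.2 by move=> /Sub; exact: ge_sup.
exists c => B; split; first split.
- by exists (0, 0) => //; exists 0 => //=; rewrite scale0r mul0r !addr0.
- move=> a _ _ _ _ [[u r] Au [b _ [<- <-]]] [[w s] Aw [d _ [<- <-]]].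
  exists (a *: u + w, a *: r + s); first exact: AP.
  exists (a * b + d) => //=; congr pair; rewrite /=.
    by rewrite scalerDl scalerDr -scalerA addrACA.
  by rewrite /GRing.scale /=; ring.
- move=> _ _ [[u r] Au [a _ [<- <-]]] /=.
  have Az (b : R) : A (b *: u, b * r).
    by have := AP b _ _ _ _ Au A0; rewrite !addr0.
  have [a0|a0|->] := ltgtP a 0; last first.
  + by rewrite scale0r mul0r !addr0; exact: Aq.
  (* Scaling by the inverse of [|a|] reduces to coefficient 1 or -1 at [v]: the upper bound on [c]
     settles [a > 0], the lower bound [a < 0]. *)
  + have /cle/= := Az a^-1.
    rewrite -(ler_pM2l a0) mulrBr mulrA divff ?gt_eqF// mul1r -qZ// scalerDr.
    rewrite scalerA divff ?gt_eqF// scale1r; lra.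
  + have a0' : 0 < - a by rewrite oppr_gt0.
    have /cge/= := Az (- a)^-1.
    rewrite -(ler_pM2l a0') mulrBr mulrA divff ?gt_eqF// mul1r -qZ// scalerBr.
    rewrite scalerA divff ?gt_eqF// scale1r scaleNr opprK; lra.
Qed.

Lemma hahn_banach (A : set (V * R^o)) : linear_graph A ->
    (forall v r, A (v, r) -> r <= q v) ->
  exists l : {linear V -> R^o},
    (forall v r, A (v, r) -> l v = r) /\ forall v, l v <= q v.
Proof.
move=> linA domA.
(* Stating [P] for the union with [A], rather than for graphs containing [A], lets the empty chain
   satisfy it too. *)
pose P (B : set (V * R^o)) := linear_graph (A `|` B) /\ dominated (A `|` B).
have [B [[linB domB] maxB]] : exists B, P B /\ forall C, B `<` C -> ~ P C.
  apply: Zorn_bigcup => F FP Ftot; split; first split.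
  - by left; case: linA.
  - have sub X : F X -> A `|` X `<=` A `|` \bigcup_(Y in F) Y.
      by move=> FX u [Au|Xu]; [left|right; exists X].
    move=> a u v r s [Au|[X FX Xu]] [Av|[Y FY Yv]].
    + by left; case: linA => _; exact.
    + by apply: (sub _ FY); have [[_ +] _] := FP _ FY; apply; [left|right].
    + by apply: (sub _ FX); have [[_ +] _] := FP _ FX; apply; [right|left].
    + have [XY|YX] := Ftot _ _ FX FY.
        apply: (sub _ FY); have [[_ +] _] := FP _ FY.
        by apply; right => //; exact: XY.
      apply: (sub _ FX); have [[_ +] _] := FP _ FX.
      by apply; right => //; exact: YX.
  - move=> v r [Av|[X FX Xv]]; first exact: domA.
    by have [_] := FP _ FX; apply; right.
(* Maximality forces the pair [(v, c)] supplied by [graph_step] to lie in [B] already. *)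
have total v : exists r, (A `|` B) (v, r).
  have [c [lin_c dom_c]] := graph_step v linB domB.
  set C := [set _ | _ in _ & _ in _] in lin_c dom_c.
  have BC : A `|` B `<=` C.
    move=> [u r] ABu; exists (u, r) => //; exists 0 => //=.
    by rewrite scale0r mul0r !addr0.
  have Cv : C (v, c).
    exists (0, 0); first by case: linB.
    by exists 1 => //=; rewrite scale1r mul1r !add0r.
  have ACC : A `|` C = C by apply: setUidr => u Au; apply: BC; left.
  exists c; right; apply: contrapT => nBv; apply: (maxB C).
    by split=> [u Bu|CB]; [apply: BC; right|exact/nBv/CB].
  by split; rewrite ACC.
have [l lP] := choice total.
have l_lin : linear (l : V -> R^o).
  move=> a u v; apply: (graph_functional linB domB (lP _)).
  by case: linB => _; apply.
pose L : {linear V -> R^o} :=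
  HB.pack (l : V -> R^o) (GRing.isLinear.Build _ _ _ _ _ l_lin).
exists L; split=> [v r Av|v]; last exact: domB (lP v).
by apply: (graph_functional linB domB (lP v)); left.
Qed.

End RealHahnBanach.

(** * From real to complex scalars *)

Definition realified (R : realType) (V : lmodType R[i]) : Type := V.

Section Realified.
Context (R : realType) (V : lmodType R[i]).

HB.instance Definition _ := GRing.Zmodule.on (realified V).

Let real_scale (a : R) (v : realified V) : realified V := a%:C *: (v : V).

Let real_scaleA a b v : real_scale a (real_scale b v) = real_scale (a * b) v.
Proof. by rewrite /real_scale scalerA -rmorphM. Qed.

Let real_scale1 : left_id 1 real_scale.
Proof. by move=> v; rewrite /real_scale scale1r. Qed.

Let real_scaleDr : right_distributive real_scale +%R.
Proof. by move=> a u v; rewrite /real_scale scalerDr. Qed.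

Let real_scaleDl v : {morph real_scale^~ v : a b / a + b}.
Proof. by move=> a b; rewrite /real_scale rmorphD scalerDl. Qed.

HB.instance Definition _ := GRing.Zmodule_isLmodule.Build R (realified V)
  real_scaleA real_scale1 real_scaleDr real_scaleDl.

End Realified.

Lemma Re_le_modulus (R : realType) (z : Cplx R) : complex.Re z <= modulus z.
Proof.
rewrite /modulus normc_def/= (le_trans (ler_norm _))// -sqrtr_sqr.
by rewrite ler_wsqrtr// lerDl sqr_ge0.
Qed.

(** A complex-linear functional is determined by its real part [f] as [f v - i f (i v)]. So the real
    theorem is applied to the real parts of the graph, over the same space with real scalars. *)
Lemma hahn_banach_complex (R : realType) (V : lmodType R[i]) (q : V -> R)
    (qD : forall u v, q (u + v) <= q u + q v)
    (qZ : forall (a : R[i]) v, q (a *: v) = modulus a * q v)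
    (A : set (V * R[i]^o)) : linear_graph A ->
    (forall v z, A (v, z) -> modulus z <= q v) ->
  exists l : {linear V -> R[i]^o},
    (forall v z, A (v, z) -> l v = z) /\ forall v, modulus (l v) <= q v.
Proof.
move=> [A0 AP] Aq.
pose B : set (realified V * R^o) := [set (u.1, complex.Re u.2) | u in A].
have Bv v z : A (v, z) -> B (v, complex.Re z) by exists (v, z).
have linB : linear_graph B.
  split=> [|a _ _ _ _ [[u z] Au [<- <-]] [[v w] Av [<- <-]]].
    by exists (0, 0).
  exists (a%:C *: u + v, a%:C *: z + w) => /=; first exact: AP.
  congr pair; rewrite raddfD /=; congr (_ + _).
  by case: (z) => x y; rewrite /GRing.scale /= mul0r subr0.
have domB v r : B (v, r) -> r <= q v.
  by move=> [[u z] Au [<- <-]]; apply: le_trans (Re_le_modulus _) (Aq _ _ Au).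
have qZ' (a : R) (v : realified V) : 0 < a -> q (a *: v) = a * q v.
  move=> a0; rewrite [LHS](qZ a%:C); congr (_ * _).
  by rewrite /modulus gtr0_norm ?ltcR.
have [f [fB fq]] := @hahn_banach R (realified V) q qD qZ' B linB domB.
pose l (v : V) : R[i]^o := f v +i* - f ('i *: v : V).
have fZ (a : R) (v : V) : f (a%:C *: v : V) = a * f v.
  exact: (linearZ_LR f a v).
have fD (u v : V) : f (u + v : V) = f u + f v by exact: (linearD f u v).
have fZC (x y : R) (v : V) :
    f ((x +i* y) *: v : V) = x * f v + y * f ('i *: v : V).
  rewrite -!fZ -fD scalerA -scalerDl; congr (f _); congr (_ *: v).
  apply/eqP; rewrite eq_complex /=.
  by rewrite !(mul0r, mulr0, mulr1, addr0, subr0, add0r) !eqxx.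
have l_lin : linear l.
  move=> [x y] u v; rewrite /l scalerDr !fD scalerA.
  have -> : 'i * (x +i* y) = - y +i* x :> R[i].
    by apply/eqP; rewrite eq_complex /=; apply/andP; split; apply/eqP; ring.
  rewrite (fZC x y) (fZC (- y) x); apply/eqP.
  rewrite /GRing.scale/= eq_complex /=; apply/andP.
  by split; apply/eqP; ring.
pose L : {linear V -> R[i]^o} :=
  HB.pack (l : V -> R[i]^o) (GRing.isLinear.Build _ _ _ _ _ l_lin).
exists L; split=> [v [x y] Av|v].
  have fv : f v = x by exact: fB (Bv _ _ Av).
  (* The graph also contains the multiple of [(v, z)] by ['i], and the real part of [i z] is minus
     the imaginary part of [z]. *)
  have fiv : f ('i *: v : V) = - y.
    have := fB _ _ (Bv _ _ (AP 'i _ _ _ _ Av A0)).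
    by rewrite !addr0 /GRing.scale /= mul0r mul1r sub0r.
  by rewrite /= /l fv fiv opprK.
(* rotate [v] so that the value of [L], hence that of [f], is the modulus *)
have [a a1 aLv] : exists2 a : R[i], `|a| = 1 & a * L v = `|L v|.
  have [->|Lv0] := eqVneq (L v) 0.
    by exists 1; rewrite ?normr1 ?mulr0 ?normr0.
  exists (`|L v| / L v); last by rewrite divfK.
  by rewrite normf_div normr_id divff// normr_eq0.
have -> : modulus (L v) = f (a *: v : V).
  by rewrite /modulus -aLv -[a * L v]/(a *: L v) -linearZ_LR.
by apply: le_trans (fq _) _; rewrite qZ /modulus a1/= mul1r.
Qed.

(** * Extension and separation by continuous functionals *)

Section NormedHahnBanach.
Context (R : realType) (V : normedModType R[i]).

Lemma hahn_banach_normed (M : R[i]) (A : set (V * R[i]^o)) : 0 <= M ->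
    linear_graph A -> (forall v z, A (v, z) -> `|z| <= M * `|v|) ->
  exists l : dual_space V,
    (forall v z, A (v, z) -> sval l v = z) /\ forall v, `|sval l v| <= M * `|v|.
Proof.
(* Norms take values in [R[i]], whereas the dominating seminorm must be real-valued; [qE] shows that
   taking the real part loses nothing. *)
move=> M0 linA Adom; pose q (v : V) := complex.Re (M * `|v|).
have qE v : M * `|v| = (q v)%:C by rewrite RRe_real// ger0_real// mulr_ge0.
have [l [lA lq]] : exists l : {linear V -> R[i]^o},
    (forall v z, A (v, z) -> l v = z) /\ forall v, modulus (l v) <= q v.
  apply: hahn_banach_complex linA _.
  - by move=> u v; rewrite -lecR rmorphD/= -!qE -mulrDr ler_wpM2l// ler_normD.
  - move=> a v; apply: complexI; rewrite rmorphM/= -!qE -modulusE.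
    by rewrite normrZ mulrCA.
  - by move=> v z Av; rewrite -lecR -modulusE -qE; exact: Adom.
have ql v : `|l v| <= M * `|v| by rewrite modulusE qE lecR.
have cl : continuous l.
  apply: bounded_linear_continuous; apply/linear_boundedP.
  exists M; split; first exact: ger0_real.
  move=> r Mr v; rewrite (le_trans (ql v))// ler_wpM2r// ltW//.
by exists (exist _ l cl).
Qed.

(** The pairs [(T u, f u)] form a linear graph, dominated by [M] times the norm because [T]
    preserves norms. *)
Lemma dual_extension (U : normedModType R[i]) (T : {linear U -> V})
    (M : R[i]) (f : {linear U -> R[i]^o}) :
    0 <= M -> (forall u, `|T u| = `|u|) -> (forall u, `|f u| <= M * `|u|) ->
  exists l : dual_space V,
    (forall u, sval l (T u) = f u) /\ forall v, `|sval l v| <= M * `|v|.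
Proof.
move=> M0 T_isom fM; pose A : set (V * R[i]^o) := range (fun u => (T u, f u)).
have [|_ _ [u _ [<- <-]]|l [lA lM]] := @hahn_banach_normed M A M0.
- split=> [|a _ _ _ _ [u _ [<- <-]] [v _ [<- <-]]].
    by exists 0; rewrite // !linear0.
  by exists (a *: u + v); rewrite // !linearP.
- by rewrite T_isom.
- by exists l; split=> // u; apply: lA; exists u.
Qed.

(** If [v] had distance at least [e] from the range, then [T u + a *: v |-> a * e] would be bounded
    by the norm, since [T u + a *: v = a *: (v - T (- a^-1 *: u))]. Its extension vanishes on the
    range but not at [v]. *)
Lemma dual_separation (U : lmodType R[i]) (T : {linear U -> V}) (v : V) :
    (forall l : dual_space V, (forall u, sval l (T u) = 0) -> sval l v = 0) ->
  forall e : R, 0 < e -> exists u, `|v - T u| < e%:C.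
Proof.
move=> vT e e0; apply: contrapT => /forallNP far.
have {}far u : e%:C <= `|v - T u|.
  rewrite real_leNgt ?normr_real//; first by apply/negP; exact: far.
  by apply/complex_realP; exists e.
pose A : set (V * R[i]^o) :=
  range (fun ua : U * R[i] => (T ua.1 + ua.2 *: v, ua.2 * e%:C : R[i]^o)).
have [|_ _ [[u a] _ [<- <-]]|l [lA _]] := @hahn_banach_normed 1 A ler01.
- split=> [|a _ _ _ _ [[u b] _ [<- <-]] [[w c] _ [<- <-]]].
    by exists (0, 0); rewrite //= linear0 scale0r mul0r addr0.
  exists (a *: u + w, a * b + c) => //=; congr pair.
    by rewrite linearP scalerDl scalerDr -scalerA addrACA.
  by rewrite /GRing.scale/= mulrDl mulrA.
- rewrite mul1r /=; have [->|a0] := eqVneq a 0.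
    by rewrite mul0r normr0.
  have -> : T u + a *: v = a *: (v - T (- a^-1 *: u)).
    rewrite linearZ_LR scaleNr opprK scalerDr scalerA divff// scale1r.
    by rewrite addrC.
  rewrite !normrZ ler_wpM2l// gtr0_norm ?ltcR//.
- have lv : sval l v = e%:C.
    by apply: lA; exists (0, 1); rewrite //= linear0 add0r scale1r mul1r.
  have := vT l; rewrite lv => /(_ _) H.
  have : e%:C = 0 :> R[i].
    apply: H => u; apply: lA; exists (u, 0); rewrite //= scale0r addr0 mul0r//.
  by case=> /eqP; rewrite gt_eqF.
Qed.

End NormedHahnBanach.

(** * Weak topologies *)

Section WeakTopology.
Context (K : numFieldType).

Lemma weak_cvgP (V : normedModType K) (F : set_system V) (v : V) : Filter F ->
  F --> (v : weak_topology V) <->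
  forall l : dual_space V, sval l @ F --> (sval l v : K^o).
Proof.
move=> FF; rewrite cvg_sup; split=> Fv l.
  by move=> B /(@initial_continuous _ _ (sval l) v) lB; exact: (Fv l).
move=> A /= [_ [[B Bop <-] /= Bv BA]].
have /Fv : nbhs (sval l v : K^o) B by apply: open_nbhs_nbhs.
by rewrite nbhs_filterE => FB; exact: (filterS BA FB).
Qed.

(** Composing with [T] turns functionals on [V] into functionals on [U]. *)
Lemma weak_continuous (U V : normedModType K) (T : {linear U -> V}) :
  continuous T -> continuous (T : weak_topology U -> weak_topology V).
Proof.
move=> cT u.
have Fu : Filter (nbhs (u : weak_topology U)) by exact: nbhs_filter.
apply/(weak_cvgP _ (fmap_filter T Fu)) => l.
pose lT : {linear U -> K^o} := sval l \o T.
have clT : continuous lT.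
  by move=> x; apply: continuous_comp; [exact: cT|exact: (svalP l)].
exact: ((weak_cvgP u Fu).1 (fun A uA => uA) (exist _ lT clT)).
Qed.

End WeakTopology.

(** * Weak compactness pulled back along an isometry with closed range *)

Section WeakCompactness.
Context (R : realType) (U V : normedModType R[i]) (T : {linear U -> V}).
Hypothesis T_isometry : forall u, `|T u| = `|u|.
Hypothesis T_closed : forall v : V,
  (forall e : R, 0 < e -> exists u, `|v - T u| < e%:C) -> exists u, v = T u.

Let dual_bounded (W : normedModType R[i]) (l : dual_space W) :
  exists2 M : R[i], 0 <= M & forall w, `|sval l w| <= M * `|w|.
Proof.
have /linear_boundedP[M [Mr lM]] :=
  (linear_bounded_continuous (sval l)).2 (svalP l).
(* The bound holds only for constants strictly above [M], and [M] may be negative. *)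
exists (`|M| + 1); first by rewrite addr_ge0.
by apply: lM; rewrite ltr_pwDr// real_ler_norm.
Qed.

Lemma weak_compact_preimage (K : set V) :
  @compact (weak_topology V) K -> @compact (weak_topology U) (T @^-1` K).
Proof.
rewrite (@compact_ultra (weak_topology U)) => cK F FF FK.
have FT : ProperFilter (T @ F) by exact: fmap_proper_filter.
have [v [Kv clv]] := cK (T @ F) FT FK.
(* An ultrafilter converges to each of its cluster points. *)
have Tv : T @ F --> (v : weak_topology V).
  move=> A vA; have [//|FnA] := in_ultra_setVsetC (T @^-1` A) FF.
  by have [w []] := clv (~` A) A FnA vA.
(* A functional vanishing on the range vanishes at the weak limit [v], so by separation [v] is a
   norm limit of the range. *)
have [u vE] : exists u, v = T u.
  apply: T_closed; apply: dual_separation => l lT.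
  have /(weak_cvgP v (fmap_filter T _))/(_ l) lv := Tv.
  have l0 : (sval l \o T) @ F --> (0 : R[i]^o).
    have -> : sval l \o T = cst 0 by apply/funext => w; exact: lT.
    exact: cvg_cst.
  exact: (cvg_unique (@norm_hausdorff _ R[i]^o) lv l0).
exists u; split; first by rewrite /= -vE.
apply/(weak_cvgP u _) => l.
have [M M0 lM] := dual_bounded l.
(* Every functional on [U] is some [L] composed with [T], so weak convergence of the images to [T u]
   is weak convergence to [u]. *)
have [L [LT _]] := dual_extension M0 T_isometry lM.
have /(weak_cvgP v (fmap_filter T _))/(_ L) := Tv.
rewrite vE LT.
suff -> : sval l = sval L \o T :> (U -> R[i]^o) by [].
by apply/funext => w /=; rewrite LT.
Qed.
End WeakCompactness.

(** * Spaces of functions *)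

Section SupNormTheory.
Context (R : realType) (T : Type) (F : funSpace R T).
Implicit Types f : funType F.

Lemma fun_le_norm f t : `|f t| <= `|f|.
Proof.
have [M [/complex_realP[m ->] Mf]] := fun_mem_bounded (set_mem (fun_valP f)).
rewrite modulusE [leRHS]/Num.norm/= /sup_norm lecR.
apply: ub_le_sup; last by exists t.
exists (m + 1) => _ [s _ <-]; rewrite -lecR -modulusE.
by apply: Mf => //; rewrite ltcR ltrDl.
Qed.

Lemma fun_norm_le f (M : R) : 0 <= M ->
  (forall t, `|f t| <= M%:C) -> `|f| <= M%:C.
Proof.
move=> M0 fM; rewrite [leLHS]/Num.norm/= /sup_norm lecR.
have [->|/set0P ne] :=
  eqVneq [set modulus (f t) | t in [set: T]] set0; first by rewrite sup0.
by apply: ge_sup => // _ [t _ <-]; rewrite -lecR -modulusE.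
Qed.

Let eval_fun t f : R[i]^o := f t.

Let eval_linear t : linear (eval_fun t).
Proof. by []. Qed.

Definition eval t : {linear funType F -> R[i]^o} :=
  HB.pack (eval_fun t) (GRing.isLinear.Build _ _ _ _ _ (eval_linear t)).

Lemma eval_continuous t : continuous (eval t).
Proof.
apply: bounded_linear_continuous; apply/linear_boundedP.
exists 1; split=> // r r1 f.
by rewrite (le_trans (fun_le_norm f t))// ler_peMl// ltW.
Qed.

(** Point evaluations are continuous functionals and separate functions. *)
Lemma weak_hausdorff : hausdorff_space (weak_topology (funType F)).
Proof.
move=> f g fg; apply/val_inj/funext => t.
have ct : continuous (eval t : weak_topology (funType F) -> R[i]^o).
  move=> h.
  have Fh : Filter (nbhs (h : weak_topology (funType F))) by exact: nbhs_filter.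
  exact: ((weak_cvgP h Fh).1 (fun A hA => hA) (exist _ _ (@eval_continuous t))).
apply: (@norm_hausdorff _ R[i]^o) => A B fA gB.
have [h [hA hB]] := fg _ _ (ct f _ fA) (ct g _ gB).
by exists (eval t h).
Qed.

End SupNormTheory.

(** * The maps from C(X) to C_u(G) given by orbits *)

Section OrbitMap.
Context (R : realType) (G : topologicalZmodType) (X : dynamicalSystem R G).
Implicit Types (x p : X) (f : CX X).

Let orbit_fun_linear x : linear ((@orbit_fun R G X)^~ x : CX X -> Cu R G).
Proof. by move=> a f g; apply/val_inj/funext. Qed.

Definition orbit_map x : {linear CX X -> Cu R G} :=
  HB.pack ((@orbit_fun R G X)^~ x : CX X -> Cu R G)
    (GRing.isLinear.Build _ _ _ _ _ (orbit_fun_linear x)).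

Lemma orbit_map_norm_le x f : `|orbit_map x f| <= `|f|.
Proof.
have fE : (complex.Re `|f|)%:C = `|f| by rewrite RRe_real// normr_real.
rewrite -fE; apply: fun_norm_le => [|t].
  by rewrite -lecR fE; exact: normr_ge0.
by rewrite fE; exact: (fun_le_norm f (act t x)).
Qed.

Lemma orbit_map_continuous x : continuous (orbit_map x).
Proof.
apply: bounded_linear_continuous; apply/linear_boundedP.
exists 1; split=> // r r1 f.
by rewrite (le_trans (orbit_map_norm_le x f))// ler_peMl// ltW.
Qed.

(** Commutativity of [G] enters here: [s - t] acts as [s] followed by [- t]. *)
Lemma translate_orbit_map f x t :
  translate (orbit_map x f) t = orbit_map x (shift_fun f (- t)).
Proof.
by apply/val_inj/funext => s /=; rewrite addrC actD.
Qed.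

Lemma transitive_norm_le p f (M : R) : transitive_point p ->
  (forall t, `|f (act t p)| <= M%:C) -> forall x, `|f x| <= M%:C.
Proof.
move=> p_trans fM x; rewrite modulusE lecR; apply/ler_addgt0Pr => e e0.
have cf : continuous f := set_mem (fun_valP f).
have e0' : 0 < e%:C :> R[i] by rewrite ltcR.
have /cvgrPdist_lt/(_ _ e0') := cf x.
rewrite -nbhs_nearE nbhsE => -[U [Uop Ux] Uf].
(* Density gives an orbit point [y] so near [x] that [f x] and [f y] differ by less than [e]. *)
have [y [/Uf/= fxy [t _ tp]]] := p_trans U (ex_intro _ x Ux) Uop.
rewrite -lecR -modulusE rmorphD/= -(subrK (f y) (f x)).
by rewrite (le_trans (ler_normD _ _))// addrC lerD//; [rewrite -tp|exact: ltW].
Qed.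

Lemma orbit_map_isometry p f : transitive_point p -> `|orbit_map p f| = `|f|.
Proof.
move=> p_trans; apply/eqP; rewrite eq_le orbit_map_norm_le/=.
have fE : (complex.Re `|orbit_map p f|)%:C = `|orbit_map p f|.
  by rewrite RRe_real// normr_real.
rewrite -fE; apply: fun_norm_le => [|x].
  by rewrite -lecR fE; exact: normr_ge0.
apply: (transitive_norm_le p_trans) => t; rewrite fE.
exact: (fun_le_norm (orbit_map p f) t).
Qed.

Lemma orbit_map_range_closed p (g : Cu R G) : transitive_point p ->
    (forall e : R, 0 < e -> exists f, `|g - orbit_map p f| < e%:C) ->
  exists f, g = orbit_map p f.
Proof.
move=> p_trans gp.
have ext x : exists l : dual_space (Cu R G),
    (forall f, sval l (orbit_map p f) = f x) /\ forall h, `|sval l h| <= `|h|.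
  have [f|f|l [lp l1]] :=
    @dual_extension _ _ _ (orbit_map p) 1 (eval _ x) ler01.
  - exact: orbit_map_isometry.
  - by rewrite mul1r; exact: fun_le_norm.
  - by exists l; split=> // h; rewrite (le_trans (l1 h))// mul1r.
have [E EP] := choice ext.
pose h x : R[i]^o := sval (E x) g.
(* [h x - f x] is the contraction [E x] applied to [g - orbit_map p f], which makes the estimate
   uniform in [x]. *)
have hP e f : `|g - orbit_map p f| < e%:C -> forall x, `|h x - f x| < e%:C.
  move=> gf x; have [Ep E1] := EP x; apply: le_lt_trans gf.
  by rewrite -(Ep f) /h -linearB E1.
have ch : continuous h.
  (* A positive element of [R[i]] has zero imaginary part, so [e] may be taken real. *)
  move=> x; apply/cvgrPdist_lt => e; rewrite ltcE/= => /andP[/eqP ei e0].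
  have {ei} -> : e = (complex.Re e)%:C by case: e ei e0 => a b /= ->.
  move: (complex.Re e) e0 => {}e e0.
  have e30 : 0 < e / 3 by rewrite divr_gt0.
  have [f /hP hf] := gp _ e30.
  have cf : continuous f := set_mem (fun_valP f).
  have e30' : 0 < (e / 3)%:C :> R[i] by rewrite ltcR.
  have /cvgrPdist_lt/(_ _ e30') := cf x.
  apply: filterS => y fxy.
  have -> : h x - h y = (h x - f x) + (f x - f y) - (h y - f y) by ring.
  have -> : e = e / 3 + e / 3 + e / 3 by field.
  rewrite !rmorphD/= (le_lt_trans (ler_normB _ _))// ltrD//.
  by rewrite (le_lt_trans (ler_normD _ _))// ltrD.
exists (Defs.mkfun (F := continuous_funSpace R (@phase_compact R G X)) ch).
apply/val_inj/funext => t; apply/eqP; rewrite -subr_eq0 -normr_le0.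
rewrite modulusE lecR; apply/ler_addgt0Pr => e e0.
have e20 : 0 < e / 2 by rewrite divr_gt0.
(* Both [g t] and [h (act t p)] lie within [e / 2] of [f (act t p)]. *)
have [f gf] := gp _ e20.
rewrite add0r -lecR -modulusE [e]splitr rmorphD/=.
have -> : g t - h (act t p) =
    (g - orbit_map p f) t - (h (act t p) - f (act t p)).
  rewrite -[(g - _) t]/(g t - f (act t p)); ring.
rewrite (le_trans (ler_normB _ _))// lerD//; last exact/ltW/hP.
exact: le_trans (fun_le_norm _ t) (ltW gf).
Qed.

Lemma wap_system_point x : wap_system X -> wap_point x.
Proof.
move=> Xwap f; rewrite /wap_fun precompactE.
set A := range (shift_fun f).
have cK : @compact (weak_topology (Cu R G))
    (orbit_map x @` @closure (weak_topology (CX X)) A).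
  apply: (@continuous_compact (weak_topology (CX X)) (weak_topology (Cu R G))).
    apply/continuous_subspaceT/weak_continuous; exact: orbit_map_continuous.
  exact: Xwap.
apply: (subclosed_compact _ cK); first exact: closed_closure.
(* The image, compact in a Hausdorff space, is closed; it therefore contains the closure of the
   translates as soon as it contains the translates. *)
rewrite [X in _ `<=` X](@closure_id (weak_topology (Cu R G)) _).1; last first.
  by apply: compact_closed cK; exact: weak_hausdorff.
apply: closure_subset => _ [t _ <-]; exists (shift_fun f (- t)).
  by apply: subset_closure; exists (- t).
exact/esym/translate_orbit_map.
Qed.

Lemma wap_point_system p : transitive_point p -> wap_point p -> wap_system X.
Proof.
move=> p_trans p_wap f.
have := p_wap f; rewrite /wap_fun precompactE.
set K := closure _ => cK.
have cTK : @compact (weak_topology (CX X)) (orbit_map p @^-1` K).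
  apply: weak_compact_preimage cK.
  - by move=> h; exact: orbit_map_isometry.
  - by move=> g; exact: orbit_map_range_closed.
apply: (subclosed_compact _ cTK); first exact: closed_closure.
(* Likewise the compact preimage is weakly closed, so it is enough that it contains each shift of
   [f]. *)
rewrite [X in _ `<=` X](@closure_id (weak_topology (CX X)) _).1; last first.
  by apply: compact_closed cTK; exact: weak_hausdorff.
apply: closure_subset => _ [t _ <-].
apply: (@subset_closure (weak_topology (Cu R G))).
exists (- t) => //.
by rewrite -[orbit_fun f p]/(orbit_map p f) translate_orbit_map opprK.
Qed.

End OrbitMap.

Theorem theorem5p5 (R : realType) (G : topologicalZmodType)
    (G_locally_compact : locally_compact [set: G])
    (G_sigma_compact : sigma_compact G)
    (X : dynamicalSystem R G) (p : X) (p_transitive : transitive_point p) :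
  [<-> wap_system X;
       forall x : X, wap_point x;
       wap_point p].
Proof.
tfae=> [Xwap x| |].
- exact: wap_system_point.
- exact.
- exact: wap_point_system.
Qed.
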